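(* Let $\mathcal{A}\subseteq\{\mathsf{N},\mathsf{M},\mathsf{C}\}$. If $A\in\mathsf{E}\mathcal{A}$, then the linear nested sequent $\;\Rightarrow A$ is derivable in $\mathsf{LNS}_{\mathsf{E}\mathcal{A}}$ extended with contraction and weakening.
   Context: Formulas are built from propositional variables, $\bot,\top,\neg,\land,\lor,\to,\Box$. The logic $\mathsf{E}\mathcal{A}$ is the smallest set of formulas containing all propositional tautologies and the axioms in $\mathcal{A}$, closed under modus ponens and the rule (E): from $A\to B$ and $B\to A$ infer $\Box A\to\Box B$, where the axioms are $\mathsf{M}: \Box(A\land B)\to(\Box A\land\Box B)$, $\mathsf{C}: (\Box A\land\Box B)\to\Box(A\land B)$, $\mathsf{N}: \Box\top$. Linear nested sequents for this setting are given by the grammar $\mathcal{X}::=\Gamma\Rightarrow\Delta\mid\Gamma\Rightarrow\Delta\,/_{\mathsf e}(\Sigma\Rightarrow\Pi;\Omega\Rightarrow\Theta)\mid\Gamma\Rightarrow\Delta\,/\,\mathcal{X}$ (finite multisets of formulas; the binary nesting $/_{\mathsf e}$ may only occur at the end). $\mathcal{S}\{\Gamma\Rightarrow\Delta\}$ denotes such a structure with a distinguished component; $\mathcal{G}/\Gamma\Rightarrow\Delta$ denotes one whose last component is $\Gamma\Rightarrow\Delta$ (prefix possibly empty). $\mathsf{LNS}_{\mathsf{E}\mathcal{A}}$ consists of: propositional rules (zero-premiss $\mathcal{S}\{\Gamma,p\Rightarrow p,\Delta\}$ for atomic $p$, $\mathcal{S}\{\Gamma,\bot\Rightarrow\Delta\}$,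 $\mathcal{S}\{\Gamma\Rightarrow\top,\Delta\}$, and the standard two-sided invertible rules for $\neg,\land,\lor,\to$ acting on one component, e.g. $\to_L$: from $\mathcal{S}\{\Gamma,B\Rightarrow\Delta\}$ and $\mathcal{S}\{\Gamma\Rightarrow A,\Delta\}$ infer $\mathcal{S}\{\Gamma,A\to B\Rightarrow\Delta\}$), which may not be applied to the sequents inside the nesting $/_{\mathsf e}$; the rules $\Box^{\mathsf e}_R$: from $\mathcal{G}/\Gamma\Rightarrow\Delta\,/_{\mathsf e}(\Rightarrow B;B\Rightarrow)$ infer $\mathcal{G}/\Gamma\Rightarrow\Box B,\Delta$; $\Box^{\mathsf e}_L$: from $\mathcal{G}/\Gamma\Rightarrow\Delta/\Sigma,A\Rightarrow\Pi$ and $\mathcal{G}/\Gamma\Rightarrow\Delta/\Omega\Rightarrow A,\Theta$ infer $\mathcal{G}/\Gamma,\Box A\Rightarrow\Delta\,/_{\mathsf e}(\Sigma\Rightarrow\Pi;\Omega\Rightarrow\Theta)$; and for each element of $\mathcal{A}$ the rule: $\mathsf{N}$: from $\mathcal{G}/\Gamma\Rightarrow\Delta/\Rightarrow B$ infer $\mathcal{G}/\Gamma\Rightarrow\Box B,\Delta$; $\mathsf{M}$: from $\mathcal{G}\,/_{\mathsf e}(\Sigma\Rightarrow\Pi;\Omega,\bot\Rightarrow\Theta)$ infer $\mathcal{G}\,/_{\mathsf e}(\Sigma\Rightarrow\Pi;\Omega\Rightarrow\Theta)$; $\mathsf{C}$: from $\mathcal{G}/\Gamma\Rightarrow\Delta\,/_{\mathsf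 e}(\Sigma,A\Rightarrow\Pi;\Omega\Rightarrow\Theta)$ and $\mathcal{G}/\Gamma\Rightarrow\Delta/\Omega\Rightarrow A,\Theta$ infer $\mathcal{G}/\Gamma,\Box A\Rightarrow\Delta\,/_{\mathsf e}(\Sigma\Rightarrow\Pi;\Omega\Rightarrow\Theta)$. Contraction and weakening are the usual left/right rules inside a component. *)

(* Defs.v *)
From Stdlib Require List.
From HB Require Import structures.
From mathcomp Require Import all_boot.
From mathcomp Require Import finmap multiset.

Set Implicit Arguments.
Unset Strict Implicit.
Unset Printing Implicit Defensive.

Open Scope mset_scope.

Inductive form : Type :=
  | Var of nat
  | Bot
  | Top
  | Neg of form
  | And of form & form
  | Or of form & form
  | Imp of form & form
  | Box of form.

(* {mset form} requires a choiceType structure on form. *)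
Fixpoint form_to_tree (A : form) : GenTree.tree nat :=
  match A with
  | Var p => GenTree.Leaf p
  | Bot => GenTree.Node 0 [::]
  | Top => GenTree.Node 1 [::]
  | Neg B => GenTree.Node 2 [:: form_to_tree B]
  | And B C => GenTree.Node 3 [:: form_to_tree B; form_to_tree C]
  | Or B C => GenTree.Node 4 [:: form_to_tree B; form_to_tree C]
  | Imp B C => GenTree.Node 5 [:: form_to_tree B; form_to_tree C]
  | Box B => GenTree.Node 6 [:: form_to_tree B]
  end.

Fixpoint form_of_tree (t : GenTree.tree nat) : form :=
  match t with
  | GenTree.Leaf p => Var p
  | GenTree.Node 0 [::] => Bot
  | GenTree.Node 1 [::] => Top
  | GenTree.Node 2 [:: t1] => Neg (form_of_tree t1)
  | GenTree.Node 3 [:: t1; t2] => And (form_of_tree t1) (form_of_tree t2)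
  | GenTree.Node 4 [:: t1; t2] => Or (form_of_tree t1) (form_of_tree t2)
  | GenTree.Node 5 [:: t1; t2] => Imp (form_of_tree t1) (form_of_tree t2)
  | GenTree.Node 6 [:: t1] => Box (form_of_tree t1)
  | _ => Bot
  end.

Lemma form_to_treeK : cancel form_to_tree form_of_tree.
Proof. by elim=> //= [A ->|A -> B ->|A -> B ->|A -> B ->|A ->]. Qed.

HB.instance Definition _ := Countable.copy form (can_type form_to_treeK).

(* A propositional tautology of the modal language is a formula true under
   every valuation, where boxed formulas count as atoms. *)
Fixpoint prop_eval (v : form -> bool) (A : form) : bool :=
  match A with
  | Var _ | Box _ => v A
  | Bot => false
  | Top => true
  | Neg B => ~~ prop_eval v B
  | And B C => prop_eval v B && prop_eval v C
  | Or B C => prop_eval v B || prop_eval v C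
  | Imp B C => prop_eval v B ==> prop_eval v C
  end.

Definition tautology (A : form) : Prop := forall v, prop_eval v A.

Inductive modal_axiom : Type := axN | axM | axC.

Inductive logic (Ax : pred modal_axiom) : form -> Prop :=
  | logic_taut A : tautology A -> logic Ax A
  | logic_M A B : axM \in Ax ->
      logic Ax (Imp (Box (And A B)) (And (Box A) (Box B)))
  | logic_C A B : axC \in Ax ->
      logic Ax (Imp (And (Box A) (Box B)) (Box (And A B)))
  | logic_N : axN \in Ax -> logic Ax (Box Top)
  | logic_MP A B : logic Ax (Imp A B) -> logic Ax A -> logic Ax B
  | logic_E A B : logic Ax (Imp A B) -> logic Ax (Imp B A) ->
      logic Ax (Imp (Box A) (Box B)).

Inductive sequent : Type := Sequent of {mset form} & {mset form}.

Notation "Gamma ⇒ Delta" := (Sequent Gamma Delta)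
  (at level 60, no associativity).

(* Comp s      is  s
   CompE s t u is  s /e (t ; u)
   Nest s X    is  s / X *)
Inductive lns : Type :=
  | Comp of sequent
  | CompE of sequent & sequent & sequent
  | Nest of sequent & lns.

(* Structures S{ } with one distinguished component; HoleEl and HoleEr
   distinguish one of the two sequents inside the nesting /e. *)
Inductive lns_ctx : Type :=
  | Hole
  | HoleE of sequent & sequent
  | HoleEl of sequent & sequent
  | HoleEr of sequent & sequent
  | HoleNest of lns
  | NestCtx of sequent & lns_ctx.

Fixpoint fill (S : lns_ctx) (s : sequent) : lns :=
  match S with
  | Hole => Comp s
  | HoleE t u => CompE s t u
  | HoleEl r u => CompE r s u
  | HoleEr r t => CompE r t s
  | HoleNest X => Nest s X
  | NestCtx r S' => Nest r (fill S' s)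
  end.

Fixpoint outside_e (S : lns_ctx) : bool :=
  match S with
  | HoleEl _ _ | HoleEr _ _ => false
  | NestCtx _ S' => outside_e S'
  | _ => true
  end.

(* G / X, with a possibly empty prefix G *)
Definition nest (G : seq sequent) (X : lns) : lns := foldr Nest X G.

(* A rule schema is a relation between the list of premisses and the
   conclusion of its instances. *)
Definition rules : Type := seq lns -> lns -> Prop.

Inductive derivable (R : rules) : lns -> Prop :=
  | derive ps X :
      R ps X -> (forall Y, List.In Y ps -> derivable R Y) -> derivable R X.

(* Propositional rules, without the proviso on the context S *)
Inductive prop_rule (S : lns_ctx) : rules :=
  | r_init (Γ Δ : {mset form}) (p : nat) :
      prop_rule S [::] (fill S (Var p +` Γ ⇒ Var p +` Δ))
  | r_botL (Γ Δ : {mset form}) :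
      prop_rule S [::] (fill S (Bot +` Γ ⇒ Δ))
  | r_topR (Γ Δ : {mset form}) :
      prop_rule S [::] (fill S (Γ ⇒ Top +` Δ))
  | r_negL (Γ Δ : {mset form}) (A : form) :
      prop_rule S [:: fill S (Γ ⇒ A +` Δ)] (fill S (Neg A +` Γ ⇒ Δ))
  | r_negR (Γ Δ : {mset form}) (A : form) :
      prop_rule S [:: fill S (A +` Γ ⇒ Δ)] (fill S (Γ ⇒ Neg A +` Δ))
  | r_andL (Γ Δ : {mset form}) (A B : form) :
      prop_rule S [:: fill S (A +` (B +` Γ) ⇒ Δ)]
        (fill S (And A B +` Γ ⇒ Δ))
  | r_andR (Γ Δ : {mset form}) (A B : form) :
      prop_rule S [:: fill S (Γ ⇒ A +` Δ); fill S (Γ ⇒ B +` Δ)]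
        (fill S (Γ ⇒ And A B +` Δ))
  | r_orL (Γ Δ : {mset form}) (A B : form) :
      prop_rule S [:: fill S (A +` Γ ⇒ Δ); fill S (B +` Γ ⇒ Δ)]
        (fill S (Or A B +` Γ ⇒ Δ))
  | r_orR (Γ Δ : {mset form}) (A B : form) :
      prop_rule S [:: fill S (Γ ⇒ A +` (B +` Δ))]
        (fill S (Γ ⇒ Or A B +` Δ))
  | r_impL (Γ Δ : {mset form}) (A B : form) :
      prop_rule S [:: fill S (B +` Γ ⇒ Δ); fill S (Γ ⇒ A +` Δ)]
        (fill S (Imp A B +` Γ ⇒ Δ))
  | r_impR (Γ Δ : {mset form}) (A B : form) :
      prop_rule S [:: fill S (A +` Γ ⇒ B +` Δ)]
        (fill S (Γ ⇒ Imp A B +` Δ)).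

Inductive LNS (Ax : pred modal_axiom) : rules :=
  | r_prop S ps X : outside_e S -> prop_rule S ps X -> LNS Ax ps X
  | r_boxR (G : seq sequent) (Γ Δ : {mset form}) (B : form) :
      LNS Ax
        [:: nest G (CompE (Γ ⇒ Δ) (mset0 ⇒ [mset B]) ([mset B] ⇒ mset0))]
        (nest G (Comp (Γ ⇒ Box B +` Δ)))
  | r_boxL (G : seq sequent) (Γ Δ Σ Π Ω Θ : {mset form}) (A : form) :
      LNS Ax
        [:: nest G (Nest (Γ ⇒ Δ) (Comp (A +` Σ ⇒ Π)));
            nest G (Nest (Γ ⇒ Δ) (Comp (Ω ⇒ A +` Θ)))]
        (nest G (CompE (Box A +` Γ ⇒ Δ) (Σ ⇒ Π) (Ω ⇒ Θ)))
  | r_N (G : seq sequent) (Γ Δ : {mset form}) (B : form) : axN \in Ax ->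
      LNS Ax
        [:: nest G (Nest (Γ ⇒ Δ) (Comp (mset0 ⇒ [mset B])))]
        (nest G (Comp (Γ ⇒ Box B +` Δ)))
  | r_M (G : seq sequent) (Γ Δ Σ Π Ω Θ : {mset form}) : axM \in Ax ->
      LNS Ax
        [:: nest G (CompE (Γ ⇒ Δ) (Σ ⇒ Π) (Bot +` Ω ⇒ Θ))]
        (nest G (CompE (Γ ⇒ Δ) (Σ ⇒ Π) (Ω ⇒ Θ)))
  | r_C (G : seq sequent) (Γ Δ Σ Π Ω Θ : {mset form}) (A : form) : axC \in Ax ->
      LNS Ax
        [:: nest G (CompE (Γ ⇒ Δ) (A +` Σ ⇒ Π) (Ω ⇒ Θ));
            nest G (Nest (Γ ⇒ Δ) (Comp (Ω ⇒ A +` Θ)))]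
        (nest G (CompE (Box A +` Γ ⇒ Δ) (Σ ⇒ Π) (Ω ⇒ Θ))).

(* Contraction and weakening may act on any component, including those inside
   /e: only the propositional rules are subject to the proviso outside_e. *)
Inductive structural : rules :=
  | r_contrL (S : lns_ctx) (Γ Δ : {mset form}) (A : form) :
      structural [:: fill S (A +` (A +` Γ) ⇒ Δ)] (fill S (A +` Γ ⇒ Δ))
  | r_contrR (S : lns_ctx) (Γ Δ : {mset form}) (A : form) :
      structural [:: fill S (Γ ⇒ A +` (A +` Δ))] (fill S (Γ ⇒ A +` Δ))
  | r_weakL (S : lns_ctx) (Γ Δ : {mset form}) (A : form) :
      structural [:: fill S (Γ ⇒ Δ)] (fill S (A +` Γ ⇒ Δ))
  | r_weakR (S : lns_ctx) (Γ Δ : {mset form}) (A : form) :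
      structural [:: fill S (Γ ⇒ Δ)] (fill S (Γ ⇒ A +` Δ)).

Definition LNS_CW (Ax : pred modal_axiom) : rules :=
  fun ps X => LNS Ax ps X \/ structural ps X.

(* Main.v *)
(** Semantic completeness of the cut-free calculus. A world is an underivable
    sequent, read as a partial valuation of atoms and boxed formulas; exhaustive
    application of the propositional rules shows that a sequent whose formulas
    no world realises is derivable. A chain of rules C between boxR and boxL amounts
    to the inference from A1, ..., An => B and B => A1, ..., B => An to
    []A1, ..., []An => []B; M removes the premisses B => Ai, and N allows n = 0.
    The neighbourhoods are chosen so that this inference refutes []B in the
    succedent of a world, while the axioms of the logic hold at every world. *)

Require Import Defs.
From mathcomp Require Import all_boot finmap multiset.
From mathcomp Require Import boolp.

Set Implicit Arguments.
Unset Strict Implicit.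
Unset Printing Implicit Defensive.

(** * Derived rules, uniform in the prefix *)

Definition nest_ctx (G : seq sequent) (S : lns_ctx) : lns_ctx :=
  foldr NestCtx S G.

Lemma fill_nest_ctx G S s : fill (nest_ctx G S) s = nest G (fill S s).
Proof. by elim: G => //= r G ->. Qed.

Lemma outside_nest_ctx G S : outside_e (nest_ctx G S) = outside_e S.
Proof. by elim: G. Qed.

(** Read upwards, a modal inference moves the current component into the prefix, so all prefixes are
    allowed at once. *)
Definition provable (Ax : pred modal_axiom) (s : sequent) : Prop :=
  forall G, derivable (LNS_CW Ax) (nest G (Comp s)).

Lemma provable_nest Ax G r s : provable Ax s ->
  derivable (LNS_CW Ax) (nest G (Nest r (Comp s))).
Proof. by move=> /(_ (rcons G r)); rewrite /nest foldr_rcons. Qed.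

Lemma provable_prop Ax ss s :
  (forall S, prop_rule S (map (fill S) ss) (fill S s)) ->
  (forall t, List.In t ss -> provable Ax t) -> provable Ax s.
Proof.
move=> rule prem G; rewrite -[nest G _](fill_nest_ctx G Hole).
apply: derive; first by left; apply: r_prop (rule _); rewrite outside_nest_ctx.
elim: ss prem {rule} => //= t ss IH prem Y [<-|inY].
  by rewrite fill_nest_ctx; apply: prem; left.
by apply: IH inY => u inu; apply: prem; right.
Qed.

Lemma provable_init Ax p (Γ Δ : {mset form}) :
  Var p \in Γ -> Var p \in Δ -> provable Ax (Γ ⇒ Δ).
Proof.
move=> /msetB1K <- /msetB1K <-.
by apply: (@provable_prop _ [::]) => // S; apply: r_init.
Qed.

(** [r_C] and [r_boxL] consume the boxed formula; contraction keeps a copy, so [Γ] stays fixed along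
    a chain and the list of boxes may repeat entries. *)
Lemma contract_nestE Ax G (Γ Δ : {mset form}) t u A : A \in Γ ->
  derivable (LNS_CW Ax) (nest G (CompE (A +` Γ ⇒ Δ) t u)) ->
  derivable (LNS_CW Ax) (nest G (CompE (Γ ⇒ Δ) t u)).
Proof.
move=> AΓ; rewrite -(msetB1K AΓ).
rewrite -!(fill_nest_ctx G (HoleE t u)) => d.
apply: derive; first by right; apply: r_contrL.
by move=> Y /= [<-|[]].
Qed.

Definition addl (s : seq form) (M : {mset form}) : {mset form} :=
  foldr (fun A N => A +` N) M s.

Lemma addl_add1 s A M : addl s (A +` M) = A +` addl s M.
Proof. by elim: s => //= B s ->; rewrite msetDCA. Qed.

(** Each [r_C] adds one formula to [Σ], so the induction keeps [Σ] general. The chain ends with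
    [r_boxL], which itself uses a formula, so the list is nonempty. *)
Lemma nestE_derivable Ax G (Γ Δ Σ Π Ω Θ : {mset form}) A As :
    {in A :: As, forall B, Box B \in Γ} -> (As = [::] \/ axC \in Ax) ->
    provable Ax (addl (A :: As) Σ ⇒ Π) ->
    {in A :: As, forall B, provable Ax (Ω ⇒ B +` Θ)} ->
  derivable (LNS_CW Ax) (nest G (CompE (Γ ⇒ Δ) (Σ ⇒ Π) (Ω ⇒ Θ))).
Proof.
elim: As A Σ => [|A' As IH] A Σ boxΓ okC down up.
  apply: (@contract_nestE _ _ _ _ _ _ (Box A)); first exact/boxΓ/mem_head.
  apply: derive; first by left; apply: r_boxL.
  move=> Y /= [<-|[<-|[]]]; apply: provable_nest => //.
  exact/up/mem_head.
case: okC => // axCAx.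
apply: (@contract_nestE _ _ _ _ _ _ (Box A)); first exact/boxΓ/mem_head.
apply: derive; first by left; apply: r_C.
move=> Y /= [<-|[<-|[]]]; last by apply/provable_nest/up/mem_head.
apply: (IH A'); first by move=> B inB; apply: boxΓ; rewrite inE inB orbT.
- by right.
- by rewrite addl_add1.
- by move=> B inB; apply: up; rewrite inE inB orbT.
Qed.

(* The number of boxed antecedents that a single modal inference can use. *)
Definition box_arity (Ax : pred modal_axiom) (n : nat) : bool :=
  match n with
  | 0 => axN \in Ax
  | 1 => true
  | _ => axC \in Ax
  end.

Lemma provable_box Ax (Γ Δ : {mset form}) As B :
    box_arity Ax (size As) -> {in As, forall A, Box A \in Γ} -> Box B \in Δ ->
    provable Ax (addl As mset0 ⇒ [mset B]) ->
    (axM \notin Ax ->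
      {in As, forall A, provable Ax ([mset B] ⇒ [mset A])}) ->
  provable Ax (Γ ⇒ Δ).
Proof.
move=> arity boxΓ /msetB1K <- down up G.
case: As arity boxΓ down up => [|A As] arity boxΓ down up.
  apply: derive; first by left; apply: r_N.
  by move=> Y /= [<-|[]]; apply: provable_nest.
apply: derive; first by left; apply: r_boxR.
move=> Y /= [<-|[]].
have okC : As = [::] \/ axC \in Ax by case: As arity {boxΓ down up}; auto.
have [axMAx|/up {}up] := boolP (axM \in Ax); last first.
  by apply: nestE_derivable boxΓ okC down _ => C /up; rewrite msetD0.
(* The added [Bot] lets [r_botL] settle every premiss that comes from the second nested sequent. *)
apply: derive; first by left; apply: r_M.
move=> Y' /= [<-|[]]; apply: nestE_derivable boxΓ okC down _ => C _.
by apply: (@provable_prop _ [::]) => // S; apply: r_botL.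
Qed.

(** * Worlds and exhaustive propositional search *)

Record world (Ax : pred modal_axiom) : Type := World {
  ante : {mset form};
  succ : {mset form};
  world_unprovable : ~ provable Ax (ante ⇒ succ)
}.

(* Three-valued (strong Kleene) evaluation, in which an atom or boxed formula is
   true when it is in the antecedent and false when it is in the succedent. *)
Fixpoint forces Ax (w : world Ax) (b : bool) (A : form) : Prop :=
  match A with
  | Var _ | Box _ => A \in if b then ante w else succ w
  | Bot => ~~ b
  | Top => b
  | Neg B => forces w (~~ b) B
  | And B C => if b then forces w b B /\ forces w b C
               else forces w b B \/ forces w b C
  | Or B C => if b then forces w b B \/ forces w b C
              else forces w b B /\ forces w b C
  | Imp B C => if b then forces w (~~ b) B \/ forces w b C
               else forces w (~~ b) B /\ forces w b C
  end.

Definition forces_all Ax (w : world Ax) (L : seq (bool * form)) : Prop :=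
  foldr (fun p P => forces w p.1 p.2 /\ P) True L.

Definition signed (b : bool) (L : seq (bool * form)) (M : {mset form}) :=
  addl [seq p.2 | p <- L & p.1 == b] M.

Fixpoint fsize (A : form) : nat :=
  match A with
  | Var _ | Bot | Top | Box _ => 1
  | Neg B => (fsize B).+1
  | And B C | Or B C | Imp B C => (fsize B + fsize C).+1
  end.

Lemma fsize_gt0 A : 0 < fsize A.
Proof. by case: A. Qed.

Definition wsize (L : seq (bool * form)) : nat := sumn [seq fsize p.2 | p <- L].

(** [L] holds the formulas still to be decomposed, [Γ] and [Δ] those set aside for good. Once [L] is
    empty, an unprovable [Γ ⇒ Δ] would itself be a world contradicting the hypothesis. *)
Lemma provable_signed Ax L (Γ Δ : {mset form}) :
    (forall w : world Ax, {subset Γ <= ante w} -> {subset Δ <= succ w} ->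
      ~ forces_all w L) ->
  provable Ax (signed true L Γ ⇒ signed false L Δ).
Proof.
have [n] := ubnP (wsize L); elim: n L Γ Δ => // n IH [|[b A] L] Γ Δ.
  move=> _ noworld; apply: contrapT => unprov.
  exact: (noworld (World unprov)).
move=> ltn noworld.
pose sq L' := signed true L' Γ ⇒ signed false L' Δ.
rewrite -/(sq _).
have park : (forall w : world Ax,
      A \in (if b then ante w else succ w) -> forces w b A) ->
    provable Ax (sq ((b, A) :: L)).
  move=> wA.
  have {}ltn : wsize L < n.
    rewrite -ltnS (leq_trans _ ltn) // ltnS -[ltnLHS]add0n ltn_add2r.
    exact: fsize_gt0.
  have subA M N : {subset A +` M <= N} -> A \in N /\ {subset M <= N}.
    move=> sub; split=> [|C CM]; apply: sub; rewrite in_mset1D ?eqxx //.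
    by rewrite CM orbT.
  case: b wA @sq noworld => wA sq noworld;
    rewrite /sq /signed /= -addl_add1; apply: IH => //.
    move=> w /subA[Aw sΓ] sΔ fL.
    by apply: (noworld w) => //; split=> //; apply: wA.
  move=> w sΓ /subA[Aw sΔ] fL.
  by apply: (noworld w) => //; split=> //; apply: wA.
(* A world realising a premiss realises the conclusion, so the hypothesis passes to every premiss,
   and these are smaller. *)
have expand Ls :
    (forall S, prop_rule S (map (fill S) (map sq Ls))
                 (fill S (sq ((b, A) :: L)))) ->
    (forall L', List.In L' Ls -> wsize L' < wsize ((b, A) :: L) /\
       forall w : world Ax, forces_all w L' -> forces_all w ((b, A) :: L)) ->
    provable Ax (sq ((b, A) :: L)).
  move=> rule smaller; apply: provable_prop rule _ => t.
  move=> /List.in_map_iff[L' [<- /smaller[ltL' imp]]].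
  apply: IH; first by rewrite -ltnS (leq_trans _ ltn).
  by move=> w sΓ sΔ /imp; apply: noworld.
(* [park] settles atoms, boxes, [Bot] on the right and [Top] on the left; the last two are forced at
   every world. *)
case: A b @sq ltn noworld park expand
    => [p|||B|B C|B C|B C|B] [] sq ltn noworld park expand;
  first [by apply: park | clear ltn noworld park].
- by apply: (@provable_prop _ [::]) => // S; apply: r_botL.
- by apply: (@provable_prop _ [::]) => // S; apply: r_topR.
- apply: (expand [:: (false, B) :: L]) => [S|L' /= [<-|[]]].
    exact: r_negL.
  by split.
- apply: (expand [:: (true, B) :: L]) => [S|L' /= [<-|[]]].
    exact: r_negR.
  by split.
- apply: (expand [:: [:: (true, B), (true, C) & L]]) => [S|L' /= [<-|[]]].
    exact: r_andL.
  by rewrite /wsize /= addnA; split=> // w [? []].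
- apply: (expand [:: (false, B) :: L; (false, C) :: L])
    => [S|L' /= [<-|[<-|[]]]]; first exact: r_andR.
    rewrite /wsize /= ltnS leq_add2r leq_addr.
    by split=> // w []; split=> //; left.
  rewrite /wsize /= ltnS leq_add2r leq_addl.
  by split=> // w []; split=> //; right.
- apply: (expand [:: (true, B) :: L; (true, C) :: L])
    => [S|L' /= [<-|[<-|[]]]]; first exact: r_orL.
    rewrite /wsize /= ltnS leq_add2r leq_addr.
    by split=> // w []; split=> //; left.
  rewrite /wsize /= ltnS leq_add2r leq_addl.
  by split=> // w []; split=> //; right.
- apply: (expand [:: [:: (false, B), (false, C) & L]]) => [S|L' /= [<-|[]]].
    exact: r_orR.
  by rewrite /wsize /= addnA; split=> // w [? []].
- apply: (expand [:: (true, C) :: L; (false, B) :: L])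
    => [S|L' /= [<-|[<-|[]]]]; first exact: r_impL.
    rewrite /wsize /= ltnS leq_add2r leq_addl.
    by split=> // w []; split=> //; right.
  rewrite /wsize /= ltnS leq_add2r leq_addr.
  by split=> // w []; split=> //; left.
- apply: (expand [:: [:: (true, B), (false, C) & L]]) => [S|L' /= [<-|[]]].
    exact: r_impR.
  by rewrite /wsize /= addnA; split=> // w [? []].
Qed.

Lemma provable_forces Ax (Γ Δ : seq form) :
    (forall w : world Ax, {in Γ, forall A, forces w true A} ->
      ~ {in Δ, forall A, forces w false A}) ->
  provable Ax (addl Γ mset0 ⇒ addl Δ mset0).
Proof.
move=> noworld; pose L := map (pair true) Γ ++ map (pair false) Δ.
have signedL b : signed b L mset0 = addl (if b then Γ else Δ) mset0.
  have pick c s : [seq p.2 | p : bool * form <- map (pair c) s & p.1 == b] =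
      if c == b then s else [::].
    by elim: s => [|C s] /=; case: eqP => //= _ ->.
  by rewrite /signed filter_cat map_cat !pick; case: (b); rewrite /= ?cats0.
rewrite -(signedL true) -(signedL false); apply: provable_signed => w _ _ fL.
have {}fL p : p \in L -> forces w p.1 p.2.
  elim: L fL {signedL} => //= q L IH [fq fL].
  by rewrite inE => /orP[/eqP->|/(IH fL)].
by apply: (noworld w) => A inA;
  [apply: (fL (true, A)) | apply: (fL (false, A))];
  rewrite mem_cat map_f ?orbT.
Qed.

(** * The canonical neighbourhood model *)

(* Two bounds rather than an equation for [X]: a world may neither force nor
   refute a formula, so the truth set is only known up to such worlds. *)
Definition nbhd Ax (w : world Ax) (X : world Ax -> bool) : Prop :=
  exists As : seq form,
    [/\ box_arity Ax (size As),
        {in As, forall A, Box A \in ante w},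
        forall v, {in As, forall A, forces v true A} -> X v
      & axM \notin Ax ->
          forall v, X v -> {in As, forall A, ~ forces v false A}].

(** Total, unlike [forces]: an atom that the world leaves undecided counts as false. *)
Fixpoint sat Ax (A : form) (w : world Ax) : bool :=
  match A with
  | Var _ => A \in ante w
  | Bot => false
  | Top => true
  | Neg B => ~~ sat B w
  | And B C => sat B w && sat C w
  | Or B C => sat B w || sat C w
  | Imp B C => sat B w ==> sat C w
  | Box B => `[< nbhd w (sat B) >]
  end.

Lemma sat_prop_eval Ax (w : world Ax) A :
  sat A w = prop_eval (fun B => sat B w) A.
Proof. by elim: A => //= [A ->|A -> B ->|A -> B ->|A -> B ->]. Qed.

(** Truth lemma, for decided formulas only; worlds need not be saturated. *)
Lemma forces_sat Ax (w : world Ax) b A : forces w b A -> sat A w = b.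
Proof.
elim: A w b => [p|||A IHA|A IHA B IHB|A IHA B IHB|A IHA B IHB|B IHB] w b /=.
- case: b => // pΔ; apply/negbTE/negP => pΓ.
  exact: (world_unprovable (provable_init Ax pΓ pΔ)).
- by case: b.
- by case: b.
- by move=> /IHA ->; rewrite negbK.
- by case: b => [[/IHA -> /IHB ->]|[/IHA ->|/IHB ->]]; rewrite ?andbF.
- by case: b => [[/IHA ->|/IHB ->]|[/IHA -> /IHB ->]]; rewrite ?orbT.
- by case: b => [[/IHA ->|/IHB ->]|[/IHA -> /IHB ->]]; rewrite ?implybT.
- case: b => [inΓ|inΔ].
    (* Arity one is allowed for every [Ax]; both bounds come from the induction hypothesis. *)
    apply/asboolP; exists [:: B]; split=> //.
    + by move=> A; rewrite inE => /eqP->.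
    + by move=> v /(_ B (mem_head _ _)) /IHB.
    + by move=> _ v Bv A; rewrite inE => /eqP-> /IHB; rewrite Bv.
  (* By the induction hypothesis, the two bounds yield the premisses of [provable_box], which would
     prove the world's own sequent. *)
  apply/asboolPn => -[As [arity boxΓ lower upper]].
  apply: (@world_unprovable _ w); apply: provable_box arity boxΓ inΔ _ _.
    rewrite -[[mset B]]msetD0.
    apply: (@provable_forces _ _ [:: B]) => v /lower Bv.
    by move=> /(_ B (mem_head _ _)) /IHB; rewrite Bv.
  move=> noM A inA; rewrite -[[mset B]]msetD0 -[[mset A]]msetD0.
  apply: (@provable_forces _ [:: B] [:: A]) => v.
  move=> /(_ B (mem_head _ _)) /IHB Bv /(_ A (mem_head _ _)).
  exact: (upper noM v Bv).
Qed.

Lemma sat_logic Ax (w : world Ax) A : logic Ax A -> sat A w.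
Proof.
move=> lA; elim: lA w => {A} [A tautA|A B axMAx|A B axCAx|axNAx
  |A B _ IHAB _ IHA|A B _ IHAB _ IHBA] w.
- by rewrite sat_prop_eval.
- apply/implyP => /asboolP[As [arity boxAs lower _]].
  (* Under [axM] the upper bound is void, so the same list serves any larger truth set. *)
  apply/andP; split; apply/asboolP; exists As; split=> //; rewrite ?axMAx //;
    by move=> v /lower /andP[].
- apply/implyP => /andP[/asboolP[As [arityA boxAs lowerA upperA]]
    /asboolP[Bs [arityB boxBs lowerB upperB]]].
  apply/asboolP; exists (As ++ Bs); split.
  + case: As arityA {boxAs lowerA upperA} => [|A1 [|A2 As]] // _;
      by case: Bs arityB {boxBs lowerB upperB}.
  + by move=> C; rewrite mem_cat => /orP[/boxAs|/boxBs].
  + move=> v fv; apply/andP; split; [apply: lowerA|apply: lowerB] => C inC;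
      by apply: fv; rewrite mem_cat inC ?orbT.
  + move=> noM v /andP[Av Bv] C; rewrite mem_cat => /orP[].
      exact: upperA.
    exact: upperB.
- by apply/asboolP; exists [::]; split.
- by have /implyP := IHAB w; apply.
(* [nbhd] sees only the truth set, so equivalent formulas have the same boxed value. *)
- have AB (v : world Ax) : sat A v = sat B v.
    by apply/idP/idP; apply/implyP; [apply: IHAB | apply: IHBA].
  have {}AB : @sat Ax A = sat B by apply/funext.
  by rewrite /= AB implybb.
Qed.

Theorem mainTheorem6 (Ax : pred modal_axiom) (A : form) :
  logic Ax A -> derivable (LNS_CW Ax) (Comp (mset0 ⇒ [mset A])).
Proof.
move=> lA; suff prA : provable Ax (mset0 ⇒ [mset A]) by apply: (prA [::]).
rewrite -[[mset A]]msetD0; apply: (@provable_forces _ [::] [:: A]) => w _.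
by move=> /(_ A (mem_head _ _)) /forces_sat; rewrite (sat_logic _ lA).
Qed.
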